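(* If $\mathcal{X}$ is a discrete function space on a tree $T$ containing the constant functions, then the differentiation operator $D$ is not an isometry on $\mathcal{X}$.
   Context: A tree $T$ is a locally finite, connected, simply-connected graph, identified with its set of vertices. A vertex is terminal if it has a unique neighbor; all trees are assumed to be without terminal vertices (hence infinite) and rooted at a vertex $o$. For $v\neq o$, $v^-$ denotes the unique neighbor of $v$ lying on the path from $o$ to $v$ (the parent of $v$). A function on $T$ is a complex-valued function on its vertices. The derivative of $f:T\to\mathbb{C}$ is $f'(v)=f(v)-f(v^-)$ for $v\neq o$ and $f'(o)=0$; the differentiation operator is $Df=f'$. A functional Banach space on a set $\Omega$ is a Banach space of complex-valued functions on $\Omega$ with pointwise vector operations, such that $f(x)=g(x)$ for all $x\in\Omega$ implies $f=g$, $f(x)=f(y)$ for every $f$ in the space implies $x=y$, and for each $x\in\Omega$ the linear functional $f\mapsto f(x)$ is continuous. A discrete function space $\mathcal{X}$ on $T$ is a functional Banach space whose elements are functions on $T$, with norm $\|\cdot\|_{\mathcal{X}}$. $D$ is an isometry on $\mathcal{X}$ if $D$ maps $\mathcal{X}$ into $\mathcal{X}$ and $\|Df\|_{\mathcal{X}}=\|f\|_{\mathcal{X}}$ for all $f\in\mathcal{X}$. *)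

(* Defs.v *)
From HB Require Import structures.
From mathcomp Require Import all_boot all_order all_algebra.
From mathcomp Require Import complex.
From mathcomp Require Import all_classical all_reals all_analysis.

Set Implicit Arguments.
Unset Strict Implicit.
Unset Printing Implicit Defensive.

Import Order.TTheory GRing.Theory Num.Theory.
Import numFieldNormedType.Exports.

Local Open Scope classical_set_scope.
Local Open Scope ring_scope.
Local Open Scope complex_scope.

(* A simple graph is a symmetric irreflexive relation. A
   two-element list satisfies [ucycle] when it runs along an edge and back, so
   simple connectedness forbids only the simple cycles of length at least 3. *)
Record rooted_tree := RootedTree {
  vertex :> choiceType;
  adj : rel vertex;
  tree_root : vertex;
  adj_sym : symmetric adj;
  adj_irr : irreflexive adj;
  adj_locally_finite : forall v, finite_set [set w | adj v w];
  adj_connected : forall v w, exists2 p, path adj v p & last v p = w;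
  adj_acyclic : forall c, ucycle adj c -> (size c <= 2)%N;
  no_terminal : forall v, ~ (exists! w, adj v w)
}.

Definition is_parent (T : rooted_tree) (v w : T) : Prop :=
  adj v w /\
  exists p : seq T, [/\ path (@adj T) (tree_root T) p, uniq (tree_root T :: p),
                        last (tree_root T) p = v & w \in tree_root T :: p].

(* The default value [v] is taken only at the root, where no path from the
   root to [v] without repetition contains a neighbor of [v]. *)
Definition parent (T : rooted_tree) (v : T) : T := xget v (is_parent v).

Definition tree_diff (R : realType) (T : rooted_tree) (f : T -> R[i]) :
    T -> R[i] :=
  fun v => if v == tree_root T then 0 else f v - f (parent v).

(* The elements of the space are the functions [fbs_val u], for [u] in a
   Banach space over the complex numbers; [fbs_val_inj] says that [u] is
   determined by the values of this function. *)
Record functional_banach_space (R : realType) (Omega : Type) :=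
  FunctionalBanachSpace {
  fbs_vector :> completeNormedModType R[i];
  fbs_val : fbs_vector -> Omega -> R[i];
  fbs_valD : forall u v x, fbs_val (u + v) x = fbs_val u x + fbs_val v x;
  fbs_valZ : forall a u x, fbs_val (a *: u) x = a * fbs_val u x;
  fbs_val_inj : forall u v, (forall x, fbs_val u x = fbs_val v x) -> u = v;
  fbs_separating : forall x y, (forall u, fbs_val u x = fbs_val u y) -> x = y;
  fbs_eval_continuous : forall x, continuous (fun u => fbs_val u x : R[i]^o)
}.

Definition fbs_functions (R : realType) (Omega : Type)
    (X : functional_banach_space R Omega) : set (Omega -> R[i]) :=
  range (@fbs_val R Omega X).

Definition discrete_function_space (R : realType) (T : rooted_tree) :=
  functional_banach_space R T.

Definition is_isometry_on (R : realType) (Omega : Type)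
    (X : functional_banach_space R Omega)
    (A : (Omega -> R[i]) -> (Omega -> R[i])) : Prop :=
  (forall f, fbs_functions X f -> fbs_functions X (A f)) /\
  (forall u v : X, fbs_val v = A (fbs_val u) -> `|v| = `|u|).

(* Main.v *)
Require Import Defs.
From mathcomp Require Import all_boot all_order all_algebra.
From mathcomp Require Import complex.
From mathcomp Require Import all_classical all_reals all_analysis.

(** An isometry is injective, whereas differentiation annihilates the constants:
    an isometry would give the constant function 1 the norm of its derivative 0,
    so that 1 would be the zero function, which its value at the root refutes. *)

Import GRing.Theory Num.Theory.

Local Open Scope ring_scope.

Lemma fbs_val0 (R : realType) (Omega : Type)
    (X : functional_banach_space R Omega) (x : Omega) :
  fbs_val (0 : X) x = 0.
Proof. by rewrite -(scale0r (0 : X)) fbs_valZ mul0r. Qed.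

Lemma tree_diff_cst (R : realType) (T : rooted_tree) (c : R[i]%C) (v : T) :
  tree_diff (fun _ => c) v = 0.
Proof. by rewrite /tree_diff subrr; case: ifP. Qed.

Local Close Scope ring_scope.
Local Open Scope complex_scope.

Theorem theorem2p12 (R : realType) (T : rooted_tree)
    (X : discrete_function_space R T)
    (X_const : forall c : R[i], fbs_functions X (fun _ : T => c)) :
  ~ is_isometry_on X (@tree_diff R T).
Proof.
move=> [_ isoD].
have [u _ u1] := X_const 1%R.
have D1 : fbs_val (0%R : X) = tree_diff (fbs_val u).
  by apply/funext => v; rewrite u1 fbs_val0 tree_diff_cst.
have u0 : u = 0%R by apply/normr0_eq0; rewrite -(isoD _ _ D1) normr0.
have /eqP := congr1 (fun f => f (tree_root T)) u1.
by rewrite u0 fbs_val0 eq_sym oner_eq0.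
Qed.
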